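(* Let $\mathcal{Q}$ be a small quantaloid, $\mathbb{C}$ a $\mathcal{Q}$-category, $X$ an object of $\mathcal{Q}$ and $x\in\mathbb{C}_X$. All cotensors with $x$ exist (i.e. $\langle f,x\rangle$ exists for every $\mathcal{Q}$-arrow $f$ with domain $X$) if and only if the functor $\mathbb{C}(-,x)\colon\mathbb{C}\to\mathcal{P}^{\dagger}X$, $y\mapsto\mathbb{C}(y,x)$, is a left adjoint in $\mathrm{Cat}(\mathcal{Q})$. In this case its right adjoint is $\langle-,x\rangle\colon\mathcal{P}^{\dagger}X\to\mathbb{C}$, $f\mapsto\langle f,x\rangle$.
   Context: A quantaloid is a category whose hom-sets are complete lattices and whose composition preserves arbitrary suprema in each variable separately. For $f\colon X\to Y$ and $g\colon X\to Z$, $\{f,g\}\colon Y\to Z$ is the largest $h$ with $h\circ f\le g$. A $\mathcal{Q}$-category $\mathbb{C}$ consists of a small set $\mathbb{C}_0$ of objects, a type $tx\in\mathcal{Q}_0$ for each $x\in\mathbb{C}_0$, and hom-arrows $\mathbb{C}(y,x)\colon tx\to ty$ with $1_{tx}\le\mathbb{C}(x,x)$ and $\mathbb{C}(z,y)\circ\mathbb{C}(y,x)\le\mathbb{C}(z,x)$. A functor $F\colon\mathbb{A}\to\mathbb{B}$ is a type-preserving map on objects with $\mathbb{A}(a',a)\le\mathbb{B}(Fa',Fa)$. An order is a reflexive transitive relation; $x'\le x$ in $\mathbb{C}$ means $tx'=tx=X$ and $1_X\le\mathbb{C}(x',x)$; $\mathbb{C}_X$ is the ordered set of objects of $\mathbb{C}$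 of type $X$. $\mathrm{Cat}(\mathcal{Q})$ is the locally ordered 2-category of $\mathcal{Q}$-categories and functors, with $F\le G$ iff $Fx\le Gx$ for all objects $x$. $F\colon\mathbb{A}\to\mathbb{B}$ is left adjoint to $G\colon\mathbb{B}\to\mathbb{A}$ if $1_{\mathbb{A}}\le G\circ F$ and $F\circ G\le 1_{\mathbb{B}}$; adjoints are determined up to isomorphism ($F\cong F'$ meaning $F\le F'\le F$). Cotensors: for $f\colon X\to Y$ and $x\in\mathbb{C}_X$, $\langle f,x\rangle$ is (if it exists) an object of type $Y$, unique up to isomorphism, with $\mathbb{C}(z,\langle f,x\rangle)=\{f,\mathbb{C}(z,x)\}$ for all $z\in\mathbb{C}_0$. $\mathcal{P}^{\dagger}X$ is the $\mathcal{Q}$-category of covariant presheaves on the one-object $\mathcal{Q}$-category $*_X$ with hom-arrow $1_X$: its objects of type $Y$ are the $\mathcal{Q}$-arrows $f\colon X\to Y$, and its hom-arrows are $\mathcal{P}^{\dagger}X(f',f)=\{f,f'\}$. (Hence its ordered set of objects of type $Y$ is $\mathcal{Q}(X,Y)^{\mathrm{op}}$.) *)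

(* Defs.v *)
From mathcomp Require Import all_boot all_order.
From mathcomp Require Import classical_sets.

Set Implicit Arguments.
Unset Strict Implicit.
Unset Printing Implicit Defensive.

Import Order.Theory.
Local Open Scope classical_set_scope.
Local Open Scope order_scope.

(* The complete lattice structure on hom-sets is given by suprema of          *)
(* arbitrary (possibly empty) subsets; [supremums A] is the set of least      *)
(* upper bounds of [A].                                                       *)
Record quantaloid := Quantaloid {
  qdisp : Order.disp_t;
  qob :> Type;
  qhom : qob -> qob -> porderType qdisp;
  qid : forall X, qhom X X;
  qcomp : forall X Y Z, qhom Y Z -> qhom X Y -> qhom X Z;
  qcomp1l : forall X Y (f : qhom X Y), qcomp (qid Y) f = f;
  qcomp1r : forall X Y (f : qhom X Y), qcomp f (qid X) = f;
  qcompA : forall W X Y Z (h : qhom Y Z) (g : qhom X Y) (f : qhom W X),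
    qcomp h (qcomp g f) = qcomp (qcomp h g) f;
  qsup : forall X Y, set (qhom X Y) -> qhom X Y;
  qsupP : forall X Y (A : set (qhom X Y)), supremums A (qsup A);
  qcomp_supl : forall X Y Z (A : set (qhom Y Z)) (f : qhom X Y),
    qcomp (qsup A) f = qsup [set qcomp g f | g in A];
  qcomp_supr : forall X Y Z (g : qhom Y Z) (A : set (qhom X Y)),
    qcomp g (qsup A) = qsup [set qcomp g f | f in A]
}.

Arguments qid {q} X.

Notation "g '\oq' f" := (qcomp g f) (at level 40, left associativity).

Section Residual.
Variable Q : quantaloid.
Implicit Types X Y Z : Q.

Definition residual X Y Z (f : qhom X Y) (g : qhom X Z) : qhom Y Z :=
  qsup [set h : qhom Y Z | h \oq f <= g].

Lemma qsup_ub X Y (A : set (qhom X Y)) h : A h -> h <= qsup A.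
Proof. by have [ub _] := qsupP A => /ub. Qed.

Lemma qsup_le X Y (A : set (qhom X Y)) k :
  (forall h, A h -> h <= k) -> qsup A <= k.
Proof. by move=> ubk; have [_ lub] := qsupP A; apply: lub. Qed.

Lemma qcomp_monol X Y Z (g g' : qhom Y Z) (f : qhom X Y) :
  g <= g' -> g \oq f <= g' \oq f.
Proof.
move=> le_gg'; suff -> : g' = qsup [set g; g'].
  by rewrite qcomp_supl; apply: qsup_ub; exists g => //; left.
apply/le_anti/andP; split; first by apply: qsup_ub; right.
by apply: qsup_le => h [] ->.
Qed.

Lemma qcomp_monor X Y Z (g : qhom Y Z) (f f' : qhom X Y) :
  f <= f' -> g \oq f <= g \oq f'.
Proof.
move=> le_ff'; suff -> : f' = qsup [set f; f'].
  by rewrite qcomp_supr; apply: qsup_ub; exists f => //; left.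
apply/le_anti/andP; split; first by apply: qsup_ub; right.
by apply: qsup_le => h [] ->.
Qed.

Lemma residual_comp_le X Y Z (f : qhom X Y) (g : qhom X Z) :
  residual f g \oq f <= g.
Proof. by rewrite qcomp_supl; apply: qsup_le => _ [h le_hf <-]. Qed.

Lemma le_residual X Y Z (f : qhom X Y) (g : qhom X Z) (h : qhom Y Z) :
  (h <= residual f g) = (h \oq f <= g).
Proof.
apply/idP/idP => [le_h|]; last exact: (@qsup_ub _ _ [set h | h \oq f <= g]).
exact: le_trans (qcomp_monol _ le_h) (residual_comp_le f g).
Qed.

End Residual.

(* The typed set of objects t : C_0 -> Q_0 is given by its fibres:            *)
(* [cob C X] is C_X, so that C_0 is the disjoint union of the [cob C X], and  *)
(* [chom y x] is the hom-arrow C(y,x) : tx -> ty.                             *)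
Record qcategory (Q : quantaloid) := QCategory {
  cob :> Q -> Type;
  chom : forall Y X : Q, cob Y -> cob X -> qhom X Y;
  chom_id : forall (X : Q) (x : cob X), qid X <= chom x x;
  chom_comp : forall (Z Y X : Q) (z : cob Z) (y : cob Y) (x : cob X),
    chom z y \oq chom y x <= chom z x
}.

Arguments chom {Q} q {Y X}.

Record qfunctor (Q : quantaloid) (A B : qcategory Q) := QFunctor {
  fob :> forall X : Q, A X -> B X;
  fob_hom : forall (X' X : Q) (a' : A X') (a : A X),
    chom A a' a <= chom B (fob a') (fob a)
}.

Section Functors.
Variable Q : quantaloid.
Implicit Types A B C : qcategory Q.

Definition cob_le C (X : Q) (x' x : C X) : Prop := qid X <= chom C x' x.

Definition qfunctor_id A : qfunctor A A :=
  @QFunctor Q A A (fun X a => a) (fun X' X a' a => le_refl _).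

Lemma qfunctor_comp_hom A B C (G : qfunctor B C) (F : qfunctor A B)
    (X' X : Q) (a' : A X') (a : A X) :
  chom A a' a <= chom C (G _ (F _ a')) (G _ (F _ a)).
Proof. exact: le_trans (fob_hom F a' a) (fob_hom G _ _). Qed.

Definition qfunctor_comp A B C (G : qfunctor B C) (F : qfunctor A B) :
  qfunctor A C :=
  @QFunctor Q A C (fun X a => G X (F X a)) (qfunctor_comp_hom G F).

Definition qfunctor_le A B (F G : qfunctor A B) : Prop :=
  forall (X : Q) (a : A X), cob_le (F X a) (G X a).

Definition left_adjoint_to A B (F : qfunctor A B) (G : qfunctor B A) : Prop :=
  qfunctor_le (qfunctor_id A) (qfunctor_comp G F) /\
  qfunctor_le (qfunctor_comp F G) (qfunctor_id B).

Definition is_left_adjoint A B (F : qfunctor A B) : Prop :=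
  exists G : qfunctor B A, left_adjoint_to F G.

Definition is_cotensor C (X Y : Q) (f : qhom X Y) (x : C X) (c : C Y) : Prop :=
  forall (Z : Q) (z : C Z), chom C z c = residual f (chom C z x).

Lemma copresheaf_id (X Y : Q) (f : qhom X Y) : qid Y <= residual f f.
Proof. by rewrite le_residual qcomp1l. Qed.

Lemma copresheaf_comp (X Z Y W : Q)
    (h : qhom X Z) (g : qhom X Y) (f : qhom X W) :
  residual g h \oq residual f g <= residual f h.
Proof.
rewrite le_residual -qcompA.
exact: le_trans (qcomp_monor _ (residual_comp_le f g)) (residual_comp_le g h).
Qed.

(* The Q-category of covariant presheaves on the one-object Q-category *_X.   *)
Definition copresheaf (X : Q) : qcategory Q :=
  @QCategory Q (fun Y => qhom X Y) (fun Y' Y f' f => residual f f')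
    (@copresheaf_id X) (@copresheaf_comp X).

Lemma representable_hom C (X : Q) (x : C X) (Y' Y : Q) (y' : C Y') (y : C Y) :
  chom C y' y <= chom (copresheaf X) (chom C y' x) (chom C y x).
Proof. by rewrite le_residual; exact: chom_comp. Qed.

(* C(-,x) : C -> P^dagger X. *)
Definition representable C (X : Q) (x : C X) : qfunctor C (copresheaf X) :=
  @QFunctor Q C (copresheaf X) (fun Y y => chom C y x) (representable_hom x).

End Functors.

(* Main.v *)
Require Import Defs.
From mathcomp Require Import all_boot all_order.
From mathcomp Require Import boolp.

(** An adjunction of [Q]-functors can be presented either by its unit and counit
    or by equality of hom-arrows, [A(a, G b) = B(F a, b)]; the hom presentation
    moreover forces any type-preserving map [G] on objects to be a functor
    ([left_adjoint_to_hom] and [hom_left_adjoint_to]).  For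
    [F = C(-,x) : C -> P^dagger X] the right-hand side is
    [P^dagger X (C(z,x), f) = {f, C(z,x)}], so the hom presentation reads
    [C(z, G f) = {f, C(z,x)}], which is the definition of [G f] being the
    cotensor of [x] by [f].  The three claims follow; the only further
    ingredient is the axiom of choice, which selects one cotensor for each [f]
    when cotensors are merely assumed to exist. *)

Lemma chom_le_l (Q : quantaloid) (A : qcategory Q) (Y Z : Q)
    (y' y : A Y) (z : A Z) :
  cob_le y' y -> (chom A y z <= chom A y' z)%O.
Proof.
move=> le_y; rewrite -[chom A y z]qcomp1l.
exact: Order.le_trans (qcomp_monol _ le_y) (chom_comp _ _ _).
Qed.

Lemma chom_le_r (Q : quantaloid) (A : qcategory Q) (Y Z : Q)
    (y' y : A Y) (z : A Z) :
  cob_le y' y -> (chom A z y' <= chom A z y)%O.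
Proof.
move=> le_y; rewrite -[chom A z y']qcomp1r.
exact: Order.le_trans (qcomp_monor _ le_y) (chom_comp _ _ _).
Qed.

Arguments chom_le_l {Q A Y Z y' y z}.
Arguments chom_le_r {Q A Y Z y' y z}.

(** Transposition: apply [G] and precompose with the unit in one direction,
    apply [F] and postcompose with the counit in the other. *)
Lemma left_adjoint_to_hom (Q : quantaloid) (A B : qcategory Q)
    (F : qfunctor A B) (G : qfunctor B A) :
  left_adjoint_to F G ->
  forall (Z Y : Q) (a : A Z) (b : B Y),
    chom A a (G Y b) = chom B (F Z a) b.
Proof.
move=> [unit counit] Z Y a b; apply/Order.le_anti/andP; split.
  have le_b : cob_le (F Y (G Y b)) b := counit Y b.
  exact: Order.le_trans (fob_hom F a (G Y b)) (chom_le_r le_b).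
have le_a : cob_le a (G Z (F Z a)) := unit Z a.
exact: Order.le_trans (fob_hom G (F Z a) b) (chom_le_l le_a).
Qed.

Arguments left_adjoint_to_hom {Q A B F G} _ {Z Y}.

(** Taking [a := g b] in the hom equality turns [1 <= A(g b, g b)] into the
    counit [F (g b) <= b], and [b := F a] gives the unit.  The counit in turn
    makes [g] a functor: [B(b', b) <= B(F (g b'), b) = A(g b', g b)]. *)
Lemma hom_left_adjoint_to (Q : quantaloid) (A B : qcategory Q)
    (F : qfunctor A B) (g : forall Y : Q, B Y -> A Y) :
  (forall (Z Y : Q) (a : A Z) (b : B Y),
     chom A a (g Y b) = chom B (F Z a) b) ->
  exists G : qfunctor B A,
    (forall (Y : Q) (b : B Y), G Y b = g Y b) /\ left_adjoint_to F G.
Proof.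
move=> homE.
have counit (Y : Q) (b : B Y) : cob_le (F Y (g Y b)) b.
  by rewrite /cob_le -homE; exact: chom_id.
have g_hom (Y' Y : Q) (b' : B Y') (b : B Y) :
    (chom B b' b <= chom A (g Y' b') (g Y b))%O.
  by rewrite homE; exact: (chom_le_l (counit Y' b')).
exists (@QFunctor Q B A g g_hom); split=> //; split=> // Y a.
by rewrite /cob_le /= homE; exact: chom_id.
Qed.

Arguments hom_left_adjoint_to {Q A B F g}.

Theorem proposition3p2 (Q : quantaloid) (C : qcategory Q) (X : Q) (x : C X) :
  ((forall (Y : Q) (f : qhom X Y), exists c : C Y, is_cotensor f x c)
     <-> is_left_adjoint (representable x))
  /\
  (forall cot : forall Y : Q, qhom X Y -> C Y,
     (forall (Y : Q) (f : qhom X Y), is_cotensor f x (cot Y f)) ->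
     exists G : qfunctor (copresheaf X) C,
       (forall (Y : Q) (f : qhom X Y), G Y f = cot Y f) /\
       left_adjoint_to (representable x) G)
  /\
  (forall G : qfunctor (copresheaf X) C,
     left_adjoint_to (representable x) G ->
     forall (Y : Q) (f : qhom X Y), is_cotensor f x (G Y f)).
Proof.
have cot_adj (cot : forall Y : Q, qhom X Y -> C Y) :
    (forall (Y : Q) (f : qhom X Y), is_cotensor f x (cot Y f)) ->
    exists G : qfunctor (copresheaf X) C,
      (forall (Y : Q) (f : qhom X Y), G Y f = cot Y f) /\
      left_adjoint_to (representable x) G.
  move=> cotP; apply: (hom_left_adjoint_to (B := copresheaf X)) => Z Y z f.
  exact: cotP.
have adj_cot (G : qfunctor (copresheaf X) C) :
    left_adjoint_to (representable x) G ->
    forall (Y : Q) (f : qhom X Y), is_cotensor f x (G Y f).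
  by move=> adj Y f Z z; exact: (left_adjoint_to_hom adj z (f : copresheaf X Y)).
split; last by split.
split=> [cot_ex | [G adj] Y f]; last by exists (G Y f); exact: adj_cot.
have [G [_ adj]] :=
  cot_adj (fun Y f => projT1 (cid (cot_ex Y f)))
          (fun Y f => projT2 (cid (cot_ex Y f))).
by exists G.
Qed.
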